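(* Let $(M,F)$ be a conic pseudo-Finsler surface with $F$ defined on the conic sub-bundle $\mathcal A$, let $\phi:\mathcal A\to\mathbb R$ be a smooth function positively homogeneous of degree $0$ in $y$ with $\sigma+\varepsilon-(\phi_{;2})^2\neq0$ on $\mathcal A$, where $\sigma=\phi_{;2;2}+\varepsilon\mathcal I\phi_{;2}+2(\phi_{;2})^2$; put $\rho=1/(\sigma+\varepsilon-(\phi_{;2})^2)$ and $\overline F=e^{\phi}F$. Then: (i) $F\,\overline C_{ijk}=e^{2\phi}F\,C_{ijk}+e^{2\phi}\big[\varepsilon\mathcal I\sigma+\tfrac12\sigma_{;2}+\phi_{;2}(\sigma+2\varepsilon)\big]m_im_jm_k=e^{2\phi}\big[\mathcal I(1+\varepsilon\sigma)+\tfrac12\sigma_{;2}+\phi_{;2}(\sigma+2\varepsilon)\big]m_im_jm_k$; (ii) $\overline{\mathcal I}=(\varepsilon\rho)^{3/2}\big[\mathcal I(1+\varepsilon\sigma)+\tfrac12\sigma_{;2}+\phi_{;2}(\sigma+2\varepsilon)\big]$; (iii) $F\,\overline C^{\,i}_{jk}=\varepsilon\rho\Big[F\,C^i_{jk}+\big\{\varepsilon\mathcal I\sigma+\tfrac12\sigma_{;2}+\phi_{;2}(\sigma+2\varepsilon)\big\}m^im_jm_k-\varepsilon\phi_{;2}\big\{\mathcal I(1+\varepsilon\sigma)+\tfrac12\sigma_{;2}+\phi_{;2}(\sigma+2\varepsilon)\big\}\ell^im_jm_k\Big]$.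
   Context: Let $M$ be a smooth 2-dimensional manifold, $(x^1,x^2)$ local coordinates and $(x^i,y^i)$ the induced coordinates on $TM$; all formulas are in such a coordinate system and repeated indices are summed over $\{1,2\}$. Write $\dot\partial_i=\partial/\partial y^i$. A conic sub-bundle is a non-empty open subset $\mathcal A\subset TM\setminus 0$ projecting onto $M$ and closed under multiplication by positive scalars. A conic pseudo-Finsler metric on $M$ is a smooth function $F:\mathcal A\to\mathbb R$, positively homogeneous of degree $1$ in $y$, such that $g_{ij}=\tfrac12\dot\partial_i\dot\partial_jF^2$ is non-degenerate at each point of $\mathcal A$; $(g^{ij})$ is the inverse matrix. A conic pseudo-Finsler surface is equipped with its modified Berwald frame: $F$ is nowhere zero on $\mathcal A$, $\ell_i=\dot\partial_iF$, $\ell^i=y^i/F$, $\varepsilon=\pm1$ (the signature of $F$) is the sign of $\det(g_{ij})$, $m_1=-\sqrt{\varepsilon\det(g_{ij})}\,\ell^2$, $m_2=\sqrt{\varepsilon\det(g_{ij})}\,\ell^1$, $m^i=g^{ij}m_j$; thus $g_{ij}=\ell_i\ell_j+\varepsilon m_im_j$, $\ell^im_i=0$, $m^im_i=\varepsilon$. The Cartan tensor is $C_{ijk}=\tfrac12\dot\partial_kg_{ij}$, $C^i_{jk}=g^{ih}C_{hjk}$, and the main scalar $\mathcal I$ is defined by $F\,C_{ijk}=\mathcal I\,m_im_jm_k$. For a smooth function $f$ on $\mathcal A$, $f_{;2}:=\varepsilon F(\dot\partial_if)m^i$ and $f_{;2;2}:=(f_{;2})_{;2}$. Barred objects ($\overline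 g_{ij}$, $\overline m_i$, $\overline C_{ijk}$, $\overline C^{\,i}_{jk}=\overline g^{ih}\overline C_{hjk}$, $\overline{\mathcal I}$ with $\overline F\,\overline C_{ijk}=\overline{\mathcal I}\,\overline m_i\overline m_j\overline m_k$) are given by the same formulas with $\overline F$ in place of $F$, the symbol $\varepsilon$ being kept unchanged, so that $\overline m_i=e^{\phi}\sqrt{\varepsilon/\rho}\,m_i$; $\overline F$ is a conic pseudo-Finsler metric because $\sigma+\varepsilon-(\phi_{;2})^2\ne0$.
   Formalization: Part (ii) is asserted only at points where ερ > 0; where ερ < 0 (allowed by σ+ε−(φ_{;2})² ≠ 0) the square root √(ε/ρ) in m̄_i and the power (ερ)^{3/2} are not real, so the barred main scalar is undefined. *)

(* Defs.v *)
From HB Require Import structures.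
From mathcomp Require Import all_boot all_order all_algebra.
From mathcomp Require Import all_classical all_reals all_analysis.
Set Implicit Arguments.
Unset Strict Implicit.
Unset Printing Implicit Defensive.
Import Order.TTheory GRing.Theory Num.Theory.
Import numFieldNormedType.Exports.
Local Open Scope classical_set_scope.
Local Open Scope ring_scope.

Section Smoothness.
Context {R : realType} {V W : normedModType R}.

(* On a finite-dimensional V and an open O, this is the usual C^k: all iterated
   directional derivatives of order at most k exist and are continuous on O. *)
Fixpoint Ck_on (k : nat) (O : set V) (f : V -> W) : Prop :=
  (forall x, O x -> {for x, continuous f}) /\
  (if k is k'.+1 then
     forall v : V, (forall x, O x -> derivable f x v) /\
                   Ck_on k' O (fun x => 'D_v f x)
   else True).

Definition smooth_on (O : set V) (f : V -> W) : Prop := forall k, Ck_on k O f.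

End Smoothness.

(* The atlas is any smooth atlas, so it may be taken to be the maximal one.
   [chart a] and [chart_inv a] are total functions; they are meaningful only on
   [chart_dom a] and on its image. *)
Record smooth_surface (R : realType) := SmoothSurface {
  surface_carrier :> topologicalType;
  surface_hausdorff : hausdorff_space surface_carrier;
  surface_second_countable : @second_countable surface_carrier;
  chart_index : Type;
  chart_dom : chart_index -> set surface_carrier;
  chart : chart_index -> surface_carrier -> 'rV[R]_2;
  chart_inv : chart_index -> 'rV[R]_2 -> surface_carrier;
  chart_dom_open : forall a, open (chart_dom a);
  chart_img_open : forall a, open (chart a @` chart_dom a);
  chartK : forall a p, chart_dom a p -> chart_inv a (chart a p) = p;
  chart_continuous : forall a, {within chart_dom a, continuous (chart a)};
  chart_inv_continuous : forall a,
    {within chart a @` chart_dom a, continuous (chart_inv a)};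
  transition_smooth : forall a b,
    smooth_on (chart a @` (chart_dom a `&` chart_dom b))
              (chart b \o chart_inv a);
  (* a selected chart around each point *)
  chart_at : surface_carrier -> chart_index;
  chart_atP : forall p, chart_dom (chart_at p) p
}.

Section TangentBundle.
Context {R : realType} (M : smooth_surface R).

(* The pair (p, u) is the tangent vector at p whose components in the selected
   chart [chart_at p] are u. The topology and the smooth structure of TM are
   not those of the product: they are read off in the induced coordinates. *)
Definition tangent_bundle : Type := (M * 'rV[R]_2)%type.

Definition tscale (t : R) (v : tangent_bundle) : tangent_bundle :=
  (v.1, t *: v.2).

(* The tangent vector with induced coordinates z = (x, y) in the chart a: its
   base point has coordinates x, and the Jacobian of the change of coordinates
   turns the components y in a into components in the selected chart. *)
Definition of_coords (a : chart_index M) (z : 'rV[R]_2 * 'rV[R]_2) :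
    tangent_bundle :=
  let p := chart_inv a z.1 in
  (p, 'D_(z.2) (chart (chart_at p) \o chart_inv a) z.1).

Definition coord_dom (A : set tangent_bundle) (a : chart_index M) :
    set ('rV[R]_2 * 'rV[R]_2) :=
  [set z | (chart a @` chart_dom a) z.1 /\ A (of_coords a z)].

Definition coord_fun (f : tangent_bundle -> R) (a : chart_index M) :
    'rV[R]_2 * 'rV[R]_2 -> R :=
  fun z => f (of_coords a z).

Definition open_TM (A : set tangent_bundle) : Prop :=
  forall a, open (coord_dom A a).

Definition smooth_TM (A : set tangent_bundle) (f : tangent_bundle -> R) : Prop :=
  forall a, smooth_on (coord_dom A a) (coord_fun f a).

Definition pos_homogeneous (d : nat) (A : set tangent_bundle)
    (f : tangent_bundle -> R) : Prop :=
  forall v t, A v -> 0 < t -> f (tscale t v) = t ^+ d * f v.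

Record conic_subbundle (A : set tangent_bundle) : Prop := ConicSubbundle {
  conic_nonempty : A !=set0;
  conic_open : open_TM A;
  conic_slit : forall v, A v -> v.2 != 0;
  conic_onto : forall p : M, exists v, A v /\ v.1 = p;
  conic_scale : forall v t, A v -> 0 < t -> A (tscale t v)
}.

End TangentBundle.

(* Objects in induced coordinates z = (x, y); y^1 and y^2 are the entries of
   index ord0 and ord_max of z.2. *)
Section CoordinateObjects.
Context {R : realType}.
Local Notation coords := ('rV[R]_2 * 'rV[R]_2)%type.
Implicit Types (F phi f eps : coords -> R) (z : coords) (i j k : 'I_2).

Definition ydiff i f z : R := 'D_((0, delta_mx 0 i) : coords) f z.

Definition g_ F i j z : R := 2^-1 * ydiff i (ydiff j (fun w => F w ^+ 2)) z.

Definition g_mx F z : 'M[R]_2 := \matrix_(i, j) g_ F i j z.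

Definition g_inv F i j z : R := invmx (g_mx F z) i j.

Definition signature F z : R := Num.sg (\det (g_mx F z)).

Definition ell_up F i z : R := z.2 0 i / F z.

(* eps is a parameter because the frame of the transformed metric is formed
   with the signature of the original one. *)
Definition m_low eps F i z : R :=
  if i == ord0 then - (Num.sqrt (eps z * \det (g_mx F z)) * ell_up F ord_max z)
  else Num.sqrt (eps z * \det (g_mx F z)) * ell_up F ord0 z.

Definition m_up eps F i z : R := \sum_(j < 2) g_inv F i j z * m_low eps F j z.

Definition cartan F i j k z : R := 2^-1 * ydiff k (g_ F i j) z.

Definition cartan_up F i j k z : R := \sum_(h < 2) g_inv F i h z * cartan F h j k z.

(* the scalar I with F C_ijk = I m_i m_j m_k *)
Definition main_scalar eps F z : R :=
  xget 0 [set t | forall i j k,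
    F z * cartan F i j k z =
    t * m_low eps F i z * m_low eps F j z * m_low eps F k z].

(* f_{;2} *)
Definition vder2 F f z : R :=
  signature F z * F z *
  \sum_(i < 2) ydiff i f z * m_up (signature F) F i z.

Definition sigma_ F phi z : R :=
  vder2 F (vder2 F phi) z
  + signature F z * main_scalar (signature F) F z * vder2 F phi z
  + 2 * vder2 F phi z ^+ 2.

Definition rho_ F phi z : R :=
  (sigma_ F phi z + signature F z - vder2 F phi z ^+ 2)^-1.

Definition conformal F phi z : R := expR (phi z) * F z.

End CoordinateObjects.

Record conic_pseudo_finsler (R : realType) (M : smooth_surface R)
    (A : set (tangent_bundle M)) (F : tangent_bundle M -> R) : Prop :=
  ConicPseudoFinsler {
    finsler_dom : conic_subbundle A;
    finsler_smooth : smooth_TM A F;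
    finsler_homogeneous : pos_homogeneous 1 A F;
    finsler_nondegenerate : forall a z, coord_dom A a z ->
      \det (g_mx (coord_fun F a) z) != 0
  }.

(* Main.v *)
(* Everything happens in one chart and at fixed x. If f is 0-homogeneous in y,
   then df annihilates y, hence F d_i f = f_{;2} m_i. Likewise the Hessian of F
   annihilates y on both sides, so F d_i d_j F = eps m_i m_j; Euler's relation
   thus replaces the symmetry of second derivatives. With r = sqrt (eps det g),
   so that r = l_1 m_2 - l_2 m_1, one gets
     F d_k m_i = (- l_i + eps I m_i) m_k   where   I = eps r_{;2} / r,
   and differentiating g = l l + eps m m identifies I with the main scalar.
   For G = e^phi F these rules give
     d_i G = e^phi (l_i + phi_{;2} m_i)   and
     F d_i d_j G = e^phi rho^-1 m_i m_j,
   hence gbar, and one more derivative yields the Cartan tensor of G. *)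

Require Import Defs.
From HB Require Import structures.
From mathcomp Require Import all_boot all_order all_algebra.
From mathcomp Require Import all_classical all_reals all_analysis.
From mathcomp Require Import ring.
Set Implicit Arguments.
Unset Strict Implicit.
Unset Printing Implicit Defensive.
Import Order.TTheory GRing.Theory Num.Theory.
Import numFieldNormedType.Exports.
Local Open Scope classical_set_scope.
Local Open Scope ring_scope.

(** * Directional derivatives *)

(** Smoothness here means existence and continuity of iterated directional derivatives, so linearity
    of the derivative in its direction has to be proved; Euler's relation needs it to split the
    derivative along y into partial derivatives. Functions of degree 0 in y are the right class: F
    d_i f is again of degree 0, and f_{;2} is built from such products, so the rule for F d_i f
    applies alike to phi, phi_{;2}, sigma and r. Tensor identities are multiplied by F, so that each
    derivative is replaced through a frame rule and only algebra in frame components remains. Since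
    [signature] is the pointwise sign of det g, its derivative must also be shown to vanish. *)

Section DirectionalDerivative.
Context {R : realType} {V : normedModType R}.
Implicit Types (f g : V -> R) (x u v : V).

(** The two difference quotients are the same function of the increment. With the converse below,
    this reduces rules for directional derivatives to one-variable calculus along a line. *)
Lemma is_derive_line f x v (s d : R) :
  is_derive (s *: v + x) v f d -> is_derive s 1 (fun r => f (r *: v + x)) d.
Proof.
move=> [df dE].
have E : (fun h : R => h^-1 *: (((fun r => f (r *: v + x)) \o shift s) (h *: 1)
    - f (s *: v + x)))
   = (fun h => h^-1 *: ((f \o shift (s *: v + x)) (h *: v) - f (s *: v + x))).
  by apply/funext => h /=; rewrite [h *: 1]mulr1 scalerDl addrA.
by split; rewrite /derivable /derive E.
Qed.

Lemma line_is_derive f x v (d : R) :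
  is_derive (0 : R) 1 (fun r => f (r *: v + x)) d -> is_derive x v f d.
Proof.
move=> [df dE].
have E : (fun h : R => h^-1 *: (((fun r => f (r *: v + x)) \o shift 0) (h *: 1)
    - f (0 *: v + x)))
   = (fun h => h^-1 *: ((f \o shift x) (h *: v) - f x)).
  by apply/funext => h /=; rewrite [h *: 1]mulr1 scale0r add0r addr0.
by move: df dE; rewrite /derivable /derive E.
Qed.

Lemma is_derive_comp1 (h : R -> R) f x v (dh df : R) :
  is_derive x v f df -> is_derive (f x) 1 h dh ->
  is_derive x v (h \o f) (dh * df).
Proof.
move=> Hf Hh; apply: line_is_derive.
have Hl : is_derive (0 : R) 1 (fun r => f (r *: v + x)) df.
  by apply: is_derive_line; rewrite scale0r add0r.
by apply: (is_derive1_comp (f := h)); rewrite scale0r add0r.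
Qed.

Lemma is_derive_scale_dir f x v (c d : R) :
  is_derive x v f d -> is_derive x (c *: v) f (d * c).
Proof.
move=> Hf; apply: line_is_derive.
have Hl : is_derive ((0 : R) * c) 1 (fun r => f (r *: v + x)) d.
  by apply: is_derive_line; rewrite mul0r scale0r add0r.
have Hm : is_derive (0 : R) 1 (fun r : R => r * c) c.
  by apply: is_derive_eq; rewrite scaler0 add0r [_%:A]mulr1.
have -> : (fun r => f (r *: (c *: v) + x)) =
    (fun r => f (r *: v + x)) \o (fun r => r * c).
  by apply/funext => r /=; rewrite scalerA.
exact: is_derive1_comp.
Qed.

(* By the mean value theorem the increment from x + h v to x + h (u + v) is
   h times a value of the u-derivative near x. *)
Lemma is_derive_add_dir (O : set V) f x u v (d : R) : open O -> O x ->
  (forall w, O w -> derivable f w u) ->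
  {for x, continuous (fun w => 'D_u f w)} ->
  is_derive x v f d -> is_derive x (u + v) f ('D_u f x + d).
Proof.
move=> oO Ox du cu [dv dvE].
suff H : (fun h : R => h^-1 *: (f (h *: (u + v) + x) - f (h *: v + x))) @ 0^'
    --> 'D_u f x.
  have Hv : (fun h : R => h^-1 *: ((f \o shift x) (h *: v) - f x)) @ 0^' --> d.
    by rewrite -dvE; exact: dv.
  have Huv : (fun h : R => h^-1 *: ((f \o shift x) (h *: (u + v)) - f x)) @ 0^'
      --> 'D_u f x + d.
    apply: cvg_trans (cvgD H Hv); apply: near_eq_cvg; near=> h.
    transitivity (h^-1 *: (f (h *: (u + v) + x) - f (h *: v + x))
      + h^-1 *: (f (h *: v + x) - f x)); first by [].
    by rewrite -scalerDr subrKA.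
  split; first by apply/cvg_ex; exists ('D_u f x + d).
  exact: cvg_lim Huv.
apply/cvgrPdist_lt => e e0.
have /nbhs_ballP[r /= r0 rO] : nbhs x O by apply: open_nbhs_nbhs.
have /nbhs_ballP[s /= s0 sB] :
    nbhs x [set w | `|'D_u f x - 'D_u f w| < e].
  by move/cvgrPdist_lt : cu => /(_ _ e0).
(* [K] bounds the norm of t u + v for t in [0, 1], and the 1 keeps it positive; |h| < [q] then keeps
   the whole segment from x + h v to x + h (u + v) in both balls. *)
pose K := `|u| + `|v| + 1.
have K0 : 0 < K by rewrite ltr_wpDl ?addr_ge0.
pose q := Num.min r s / K.
have q0 : 0 < q by rewrite divr_gt0// lt_min r0.
rewrite near_withinE /=; near=> h => h0.
have hq : `|h| < q.
  near: h; exists q => //= y /=; by rewrite sub0r normrN.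
have inb (t : R) : 0 <= t <= 1 -> ball x (Num.min r s) (t *: (h *: u) + (h *: v + x)).
  move=> /andP[t0 t1]; rewrite -ball_normE /ball_/=.
  rewrite addrA opprD [- _ - x]addrC addNKr normrN.
  apply: (@le_lt_trans _ _ (`|h| * K)).
    rewrite (le_trans (ler_normD _ _))// !normrZ (ger0_norm t0) /K !mulrDr -addrA.
    apply: lerD; first by rewrite ler_piMl// mulr_ge0.
    by rewrite lerDl mulr1.
  by rewrite -ltr_pdivlMr.
have inO (t : R) : 0 <= t <= 1 -> O (t *: (h *: u) + (h *: v + x)).
  move=> /inb B; apply: rO; apply: le_ball B; by rewrite ge_min lexx.
have Hl (t : R) : 0 <= t <= 1 ->
    is_derive t 1 (fun t => f (t *: (h *: u) + (h *: v + x)))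
      ('D_u f (t *: (h *: u) + (h *: v + x)) * h).
  move=> t01; apply: is_derive_line; apply: is_derive_scale_dir.
  by apply: derivableP; apply: du; apply: inO.
have [c c01] : exists2 c, c \in `]0, 1[%R &
    f (1 *: (h *: u) + (h *: v + x)) - f (0 *: (h *: u) + (h *: v + x)) =
    ('D_u f (c *: (h *: u) + (h *: v + x)) * h) * (1 - 0).
  apply: (@MVT _ (fun t => f (t *: (h *: u) + (h *: v + x)))
      (fun t => 'D_u f (t *: (h *: u) + (h *: v + x)) * h) 0 1 ltr01).
    move=> t; rewrite in_itv /= => /andP[t0 t1]; apply: Hl.
    by rewrite !ltW.
  apply: derivable_within_continuous => t; rewrite in_itv /= => t01.
  by apply: ex_derive; apply: Hl.
rewrite scale1r scale0r add0r subr0 mulr1 addrA -scalerDr => ->.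
rewrite [_ *: _]mulrC mulfK//.
apply: sB; apply: (@le_ball _ _ _ (Num.min r s)); first by rewrite ge_min lexx orbT.
apply: inb; move: c01; rewrite in_itv /= => /andP[? ?]; by rewrite !ltW.
Unshelve. all: by end_near. Qed.

End DirectionalDerivative.

(** * Smooth functions on an open set *)

Section SmoothFunctions.
Context {R : realType} {V : normedModType R}.
Variable O : set V.
Hypothesis oO : open O.
Implicit Types (f g : V -> R) (x v : V).

Lemma near_open x : O x -> \forall y \near x, O y.
Proof. by move=> Ox; exact: open_nbhs_nbhs. Qed.

Lemma eq_on_near f g x : O x -> (forall y, O y -> f y = g y) ->
  \near x, f x = g x.
Proof. by move=> Ox fg; apply: filterS (near_open Ox). Qed.

Lemma eq_on_continuous f g x : (forall y, O y -> f y = g y) -> O x ->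
  {for x, continuous f} -> {for x, continuous g}.
Proof.
move=> fg Ox cf; have E := fg _ Ox.
change (g @ x --> g x); rewrite -E; apply: cvg_trans cf.
by apply: near_eq_cvg; apply: eq_on_near.
Qed.

Lemma Ck_on_continuous k f x : Ck_on k O f -> O x -> {for x, continuous f}.
Proof. by case: k => [|k] [c _] /c. Qed.

(** As [O] is open, equality on [O] is equality near each of its points, which is all that
    derivatives see. Formulas valid only on [O] may thus be substituted under a derivative. *)
Lemma Ck_on_ext k f g : (forall x, O x -> f x = g x) ->
  Ck_on k O f -> Ck_on k O g.
Proof.
elim: k f g => [|k IH] f g fg [cf df].
  by split => // x Ox; exact: eq_on_continuous fg Ox (cf _ Ox).
split; first by move=> x Ox; exact: eq_on_continuous fg Ox (cf _ Ox).
move=> v; have [dfv Cf] := df v; split.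
  move=> x Ox; apply: near_eq_derivable (dfv _ Ox).
  exact: eq_on_near.
apply: IH Cf => x Ox; apply: near_eq_derive; exact: eq_on_near.
Qed.

Lemma Ck_onW k f : Ck_on k.+1 O f -> Ck_on k O f.
Proof.
elim: k f => [|k IH] f [cf df]; first by split.
split => // v; have [dfv Cf] := df v; split => //; exact: IH.
Qed.

Lemma Ck_on_cst k (c : R) : Ck_on k O (fun=> c).
Proof.
elim: k c => [|k IH] c; split => //; try by move=> x _; exact: cst_continuous.
move=> v; split; first by move=> x _; exact: derivable_cst.
apply: Ck_on_ext (IH 0) => x _; by rewrite derive_cst.
Qed.

Lemma Ck_onD k f g : Ck_on k O f -> Ck_on k O g ->
  Ck_on k O (fun x => f x + g x).
Proof.
elim: k f g => [|k IH] f g [cf df] [cg dg].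
all: have c x (Ox : O x) : {for x, continuous (fun x => f x + g x)} by
  apply: cvgD; [exact: cf|exact: cg].
  by split.
split => // v; have [dfv Cf] := df v; have [dgv Cg] := dg v; split.
  move=> x Ox; apply: (@derivableD _ _ _ f g); [exact: dfv|exact: dgv].
apply: Ck_on_ext (IH _ _ Cf Cg) => x Ox.
by rewrite (@deriveD _ _ _ f g)//; [exact: dfv|exact: dgv].
Qed.

Lemma Ck_onM k f g : Ck_on k O f -> Ck_on k O g ->
  Ck_on k O (fun x => f x * g x).
Proof.
elim: k f g => [|k IH] f g.
  move=> [cf _] [cg _]; split => // x Ox.
  by apply: cvgM; [exact: cf|exact: cg].
move=> Hf Hg; have := Hf; have := Hg; move=> [cg dg] [cf df].
split; first by move=> x Ox; apply: cvgM; [exact: cf|exact: cg].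
move=> v; have [dfv Cf] := df v; have [dgv Cg] := dg v; split.
  move=> x Ox; apply: (@derivableM _ _ f g); [exact: dfv|exact: dgv].
have := Ck_onD (IH _ _ (Ck_onW Hf) Cg) (IH _ _ (Ck_onW Hg) Cf).
apply: Ck_on_ext => x Ox.
by rewrite (@deriveM _ _ f g)//; [exact: dfv|exact: dgv].
Qed.

(** One step of a bootstrap by the chain rule. For inverse, exponential and square root, [dh] is an
    expression in [h] itself, so induction on the order closes. *)
Lemma Ck_on_comp k (h dh : R -> R) f :
  (forall x, O x -> is_derive (f x) 1 h (dh (f x))) ->
  Ck_on k.+1 O f -> Ck_on k O (dh \o f) -> Ck_on k.+1 O (h \o f).
Proof.
move=> Hh [cf df] Cdh; split.
  move=> x Ox; apply: continuous_comp; first exact: cf.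
  apply/differentiable_continuous/derivable1_diffP.
  by have [] := Hh _ Ox.
move=> v; have [dfv Cf] := df v.
have D x (Ox : O x) := is_derive_comp1 (derivableP (dfv _ Ox)) (Hh _ Ox).
split; first by move=> x Ox; have [] := D _ Ox.
apply: Ck_on_ext (Ck_onM Cdh Cf) => x Ox.
by have [_ ->] := D _ Ox.
Qed.

Lemma Ck_on0 f : (forall x, O x -> {for x, continuous f}) -> Ck_on 0 O f.
Proof. by []. Qed.

Lemma is_derive_inv (x : R) : x != 0 ->
  is_derive x 1 (fun y : R => y^-1) (- (x^-1 * x^-1)).
Proof.
move=> x0; split; first exact: derivableV.
by rewrite deriveV// derive_id [_ *: _]mulr1 expr2 invfM.
Qed.

Lemma Ck_onV k f : (forall x, O x -> f x != 0) -> Ck_on k O f ->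
  Ck_on k O (fun x => (f x)^-1).
Proof.
move=> f0; elim: k => [|k IH] Hf.
  apply: Ck_on0 => x Ox; apply: cvgV; first exact: f0.
  exact: Ck_on_continuous Hf Ox.
apply: (@Ck_on_comp _ (fun y => y^-1) (fun y => - (y^-1 * y^-1))) => //.
  by move=> x Ox; apply: is_derive_inv; exact: f0.
have I := IH (Ck_onW Hf).
apply: Ck_on_ext (Ck_onM (Ck_on_cst k (- 1)) (Ck_onM I I)) => x _ /=.
by rewrite mulN1r.
Qed.

Lemma Ck_on_expR k f : Ck_on k O f -> Ck_on k O (fun x => expR (f x)).
Proof.
elim: k => [|k IH] Hf.
  apply: Ck_on0 => x Ox; apply: continuous_comp; last exact: continuous_expR.
  exact: Ck_on_continuous Hf Ox.
apply: (@Ck_on_comp _ expR expR) => //; exact: IH (Ck_onW Hf).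
Qed.

Lemma Ck_on_sqrt k f : (forall x, O x -> 0 < f x) -> Ck_on k O f ->
  Ck_on k O (fun x => Num.sqrt (f x)).
Proof.
move=> f0; elim: k => [|k IH] Hf.
  apply: Ck_on0 => x Ox; apply: continuous_comp; last exact: sqrt_continuous.
  exact: Ck_on_continuous Hf Ox.
apply: (@Ck_on_comp _ Num.sqrt (fun y => (2 * Num.sqrt y)^-1)) => //.
  by move=> x Ox; apply: is_derive1_sqrt; exact: f0.
apply: Ck_onV.
  by move=> x Ox; rewrite mulf_neq0// ?pnatr_eq0// gt_eqF// sqrtr_gt0 f0.
exact: Ck_onM (Ck_on_cst _ _) (IH (Ck_onW Hf)).
Qed.

Lemma smooth_on_ext f g : (forall x, O x -> f x = g x) ->
  smooth_on O f -> smooth_on O g.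
Proof. by move=> fg Hf k; exact: Ck_on_ext fg (Hf k). Qed.

Lemma smooth_on_cst (c : R) : smooth_on O (fun=> c).
Proof. by move=> k; exact: Ck_on_cst. Qed.

Lemma smooth_onD f g : smooth_on O f -> smooth_on O g ->
  smooth_on O (fun x => f x + g x).
Proof. by move=> Hf Hg k; exact: Ck_onD. Qed.

Lemma smooth_onM f g : smooth_on O f -> smooth_on O g ->
  smooth_on O (fun x => f x * g x).
Proof. by move=> Hf Hg k; exact: Ck_onM. Qed.

Lemma smooth_onN f : smooth_on O f -> smooth_on O (fun x => - f x).
Proof.
move=> Hf; apply: smooth_on_ext (smooth_onM (smooth_on_cst (- 1)) Hf) => x _.
by rewrite mulN1r.
Qed.

Lemma smooth_onX f n : smooth_on O f -> smooth_on O (fun x => f x ^+ n).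
Proof.
move=> Hf; elim: n => [|n IH]; first exact: smooth_on_cst.
by apply: smooth_on_ext (smooth_onM Hf IH) => x _; rewrite exprS.
Qed.

Lemma smooth_onV f : (forall x, O x -> f x != 0) -> smooth_on O f ->
  smooth_on O (fun x => (f x)^-1).
Proof. by move=> f0 Hf k; exact: Ck_onV. Qed.

Lemma smooth_on_expR f : smooth_on O f -> smooth_on O (fun x => expR (f x)).
Proof. by move=> Hf k; exact: Ck_on_expR. Qed.

Lemma smooth_on_sqrt f : (forall x, O x -> 0 < f x) -> smooth_on O f ->
  smooth_on O (fun x => Num.sqrt (f x)).
Proof. by move=> f0 Hf k; exact: Ck_on_sqrt. Qed.

Lemma smooth_on_derive f v : smooth_on O f -> smooth_on O (fun x => 'D_v f x).
Proof. by move=> Hf k; have [_ /(_ v)[]] := Hf k.+1. Qed.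

Lemma smooth_on_derivable f x v : smooth_on O f -> O x -> derivable f x v.
Proof. by move=> Hf Ox; have [_ /(_ v)[/(_ _ Ox)]] := Hf 1. Qed.

Lemma smooth_on_add_dir f x u v : smooth_on O f -> O x ->
  'D_(u + v) f x = 'D_u f x + 'D_v f x.
Proof.
move=> Hf Ox.
have [_ //] : is_derive x (u + v) f ('D_u f x + 'D_v f x).
apply: (is_derive_add_dir oO Ox).
- by move=> w Ow; exact: smooth_on_derivable.
- exact: Ck_on_continuous (smooth_on_derive u Hf 0) Ox.
- by apply: derivableP; exact: smooth_on_derivable.
Qed.

Lemma smooth_on_scale_dir f x c v : smooth_on O f -> O x ->
  'D_(c *: v) f x = 'D_v f x * c.
Proof.
move=> Hf Ox.
have [_ //] : is_derive x (c *: v) f ('D_v f x * c).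
by apply: is_derive_scale_dir; apply: derivableP; exact: smooth_on_derivable.
Qed.

End SmoothFunctions.

(** * Linear algebra in dimension two *)

Section PlaneAlgebra.

Lemma ord2P (i : 'I_2) : (i = ord0) + (i = ord_max).
Proof.
by case: i => [[|[|//]] Hi]; [left|right]; apply/val_inj.
Qed.

Lemma sum_ord2 (V : nmodType) (f : 'I_2 -> V) :
  \sum_(i < 2) f i = f ord0 + f ord_max.
Proof.
rewrite !big_ord_recl big_ord0 addr0; congr (_ + f _).
exact/val_inj.
Qed.

Lemma det_mx2 (R : comNzRingType) (M : 'M[R]_2) :
  \det M = M ord0 ord0 * M ord_max ord_max - M ord0 ord_max * M ord_max ord0.
Proof.
rewrite (expand_det_row _ ord0) sum_ord2 /cofactor !det_mx11 !mxE /=.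
have -> : lift ord0 (0 : 'I_1) = ord_max :> 'I_2 by apply/val_inj.
have -> : lift ord_max (0 : 'I_1) = ord0 :> 'I_2 by apply/val_inj.
by rewrite expr0 mul1r expr1 mulN1r mulrN.
Qed.

(** Raises an index without computing the entries of the inverse matrix: guess [v], then check that
    lowering it gives [w]. *)
Lemma invmx_solve (R : fieldType) (n : nat) (M : 'M[R]_n) (v w : 'I_n -> R) :
  \det M != 0 -> (forall i, \sum_j M i j * v j = w i) ->
  forall i, \sum_j invmx M i j * w j = v i.
Proof.
move=> M0 Mv i.
have uM : M \in unitmx by rewrite unitmxE unitfE.
have := mulKmx uM (\col_k v k) => /matrixP/(_ i 0); rewrite !mxE => <-.
by apply: eq_bigr => j _; rewrite mxE -Mv; congr (_ * _); apply: eq_bigr => k _;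
  rewrite mxE.
Qed.

(* A bilinear form annihilating y on both sides is a multiple of nu (x) nu with
   nu = (- y1, y0); in particular it is symmetric. *)
Lemma null_form_det (R : fieldType) (y0 y1 f0 f1 f h00 h01 h10 h11 d : R) :
  f != 0 -> y0 * f0 + y1 * f1 = f ->
  y0 * h00 + y1 * h10 = 0 -> y0 * h01 + y1 * h11 = 0 ->
  y0 * h00 + y1 * h01 = 0 -> y0 * h10 + y1 * h11 = 0 ->
  d = (f0 * f0 + f * h00) * (f1 * f1 + f * h11)
      - (f0 * f1 + f * h01) * (f1 * f0 + f * h10) ->
  [/\ f ^+ 3 * h00 = d * - y1 * - y1, f ^+ 3 * h01 = d * - y1 * y0,
      f ^+ 3 * h10 = d * y0 * - y1 & f ^+ 3 * h11 = d * y0 * y0].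
Proof.
move=> f_n0 fE e1 e2 e3 e4 ->.
(* If y0 = 0 then y1 is nonzero and only h00 survives; otherwise all entries are multiples of h11.
   Writing h = c nu (x) nu, the determinant [d] is f c (y0 f0 + y1 f1)^2 = f^3 c, whence the
   cube. *)
have [y0z|y0n] := eqVneq y0 0.
  rewrite y0z in fE e1 e2 e3 e4 *.
  have y1n : y1 != 0 by apply: contra_neq f_n0 => y1z; rewrite -fE y1z; ring.
  have h10z : h10 = 0 by apply/eqP; move/eqP : e1; rewrite mul0r add0r mulf_eq0 (negPf y1n).
  have h11z : h11 = 0 by apply/eqP; move/eqP : e2; rewrite mul0r add0r mulf_eq0 (negPf y1n).
  have h01z : h01 = 0 by apply/eqP; move/eqP : e3; rewrite mul0r add0r mulf_eq0 (negPf y1n).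
  by rewrite h10z h11z h01z -fE; split; ring.
have h00E : h00 = - (y1 * h01) / y0.
  by apply: (mulfI y0n); rewrite mulrCA divff// mulr1; apply/eqP; rewrite -subr_eq0 opprK e3.
have h01E : h01 = - (y1 * h11) / y0.
  by apply: (mulfI y0n); rewrite mulrCA divff// mulr1; apply/eqP; rewrite -subr_eq0 opprK e2.
have h10E : h10 = - (y1 * h11) / y0.
  by apply: (mulfI y0n); rewrite mulrCA divff// mulr1; apply/eqP; rewrite -subr_eq0 opprK e4.
rewrite h00E h01E h10E -fE; by split; field.
Qed.

End PlaneAlgebra.
(** * Derivatives along the fibre *)

Section CoordinateCalculus.
Context {R : realType}.
Local Notation coords := ('rV[R]_2 * 'rV[R]_2)%type.
Variable O : set coords.
Hypothesis oO : open O.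
Implicit Types (f g : coords -> R) (z : coords) (i j k : 'I_2) (t c : R).

Lemma smooth_on_ydiff i f : smooth_on O f -> smooth_on O (ydiff i f).
Proof. exact: smooth_on_derive. Qed.

Lemma eq_ydiff i f g z : (forall w, O w -> f w = g w) -> O z ->
  ydiff i f z = ydiff i g z.
Proof.
move=> fg Oz; apply: near_eq_derive.
by apply: (eq_on_near oO Oz); exact: fg.
Qed.

Lemma ydiff_cst i c z : ydiff i (fun=> c) z = 0.
Proof. exact: derive_cst. Qed.

Lemma ydiffD i f g z : smooth_on O f -> smooth_on O g -> O z ->
  ydiff i (fun w => f w + g w) z = ydiff i f z + ydiff i g z.
Proof.
by move=> Hf Hg Oz; apply: (@deriveD _ _ _ f g); exact: smooth_on_derivable Oz.
Qed.

Lemma ydiffM i f g z : smooth_on O f -> smooth_on O g -> O z ->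
  ydiff i (fun w => f w * g w) z = ydiff i f z * g z + f z * ydiff i g z.
Proof.
move=> Hf Hg Oz; rewrite [LHS](@deriveM _ _ f g); last 2 first.
- exact: smooth_on_derivable Oz.
- exact: smooth_on_derivable Oz.
by rewrite addrC; congr (_ + _); rewrite mulrC.
Qed.

Lemma ydiffN i f z : smooth_on O f -> O z ->
  ydiff i (fun w => - f w) z = - ydiff i f z.
Proof.
by move=> Hf Oz; apply: (@deriveN _ _ _ f); exact: smooth_on_derivable Oz.
Qed.

Lemma ydiffX2 i f z : smooth_on O f -> O z ->
  ydiff i (fun w => f w ^+ 2) z = 2 * f z * ydiff i f z.
Proof.
move=> Hf Oz; rewrite (@eq_ydiff i _ (fun w => f w * f w))//.
by rewrite ydiffM//; ring.
Qed.

Lemma ydiffV i f z : (forall w, O w -> f w != 0) -> smooth_on O f -> O z ->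
  ydiff i (fun w => (f w)^-1) z = - (ydiff i f z / f z ^+ 2).
Proof.
move=> f0 Hf Oz; rewrite [LHS](@deriveV _ _ f); last 2 first.
- exact: f0.
- exact: smooth_on_derivable Oz.
by rewrite scaleNr [_ *: _]mulrC.
Qed.

Lemma ydiff_expR i f z : smooth_on O f -> O z ->
  ydiff i (fun w => expR (f w)) z = expR (f z) * ydiff i f z.
Proof.
move=> Hf Oz.
have Df := derivableP (smooth_on_derivable (v := (0, delta_mx 0 i)) Hf Oz).
by have [_] := is_derive_comp1 Df (is_derive_expR (f z)).
Qed.

Lemma is_derive_fibre_coord j (z v : coords) :
  is_derive z v (fun w : coords => w.2 0 j) (v.2 0 j).
Proof.
apply: line_is_derive.
have -> : (fun r => (r *: v + z).2 0 j) = (fun r => r * v.2 0 j + z.2 0 j).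
  by apply/funext => r; rewrite /= !mxE.
by apply: is_derive_eq; rewrite scaler0 add0r addr0 [_%:A]mulr1.
Qed.

Lemma smooth_on_fibre_coord j : smooth_on O (fun w => w.2 0 j).
Proof.
have c z : {for z, continuous (fun w : coords => w.2 0 j)}.
  apply: (@continuous_comp _ _ _ snd (fun M : 'rV[R]_2 => M 0 j)).
    exact: cvg_snd.
  exact: coord_continuous.
case=> [|k]; split => // v; split.
  by move=> z _; have [] := is_derive_fibre_coord j z v.
apply: Ck_on_ext (Ck_on_cst oO k (v.2 0 j)) => // z _.
by have [_ ->] := is_derive_fibre_coord j z v.
Qed.

Lemma ydiff_fibre_coord i j z :
  ydiff i (fun w : coords => w.2 0 j) z = (i == j)%:R.
Proof.
have [_] := is_derive_fibre_coord j z (0, delta_mx 0 i).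
by rewrite /ydiff => ->; rewrite /= mxE eqxx eq_sym.
Qed.

(** * Fibre dilations and Euler's relation *)

Definition dilate t z : coords := (z.1, t *: z.2).

Hypothesis dilO : forall z (t : R), O z -> 0 < t -> O (dilate t z).

(** Moving z by s e_i moves its dilation by s (t e_i); differentiate the homogeneity relation in s.
    The factor [c] is 1 in degree 0 and t in degree 1. *)
Lemma ydiff_dilate i f z t c : 0 < t -> O z -> smooth_on O f ->
  (forall w, O w -> f (dilate t w) = c * f w) ->
  t * ydiff i f (dilate t z) = c * ydiff i f z.
Proof.
move=> t0 Oz Hf fS; have Ot := dilO Oz t0.
pose e : coords := (0, delta_mx 0 i).
have D1 : is_derive (0 : R) 1 (fun r => f (r *: (t *: e) + dilate t z))
    ('D_e f (dilate t z) * t).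
  apply: is_derive_line; rewrite scale0r add0r.
  by apply: is_derive_scale_dir; apply: derivableP; exact: smooth_on_derivable.
have D2 : is_derive (0 : R) 1 (fun r => c * f (r *: e + z)) (c * 'D_e f z).
  have D : is_derive (0 : R) 1 (fun r => f (r *: e + z)) ('D_e f z).
    apply: is_derive_line; rewrite scale0r add0r.
    by apply: derivableP; exact: smooth_on_derivable.
  by have := is_deriveM (is_derive_cst c (0 : R) 1) D; rewrite scaler0 addr0.
have E : \forall r \near (0 : R),
    f (r *: (t *: e) + dilate t z) = c * f (r *: e + z).
  have cl : {for (0 : R), continuous (fun r : R => r *: e + z)}.
    by apply: cvgD; [apply: cvgZr_tmp; exact: cvg_id|exact: cvg_cst].
  have : \forall r \near (0 : R), O (r *: e + z).
    by apply: cl; rewrite scale0r add0r; exact: near_open oO _ Oz.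
  apply: filterS => r Or; rewrite -fS//; congr f.
  rewrite /dilate [LHS]surjective_pairing /=.
  congr (_, _); first by rewrite !scaler0.
  by rewrite scalerDr scalerA mulrC -scalerA.
have [_ E1] := near_eq_is_derive E D1.
have [_ E2] := D2.
by rewrite mulrC -[LHS]E1 E2.
Qed.

(** The function r -> f (x, (1 + r) y) is differentiated at 0 twice over: as a power of 1 + r, and
    as a derivative in the vertical direction y, which splits by linearity in the direction. *)
Lemma euler_ydiff (d : nat) f z : smooth_on O f -> O z ->
  (forall t, 0 < t -> f (dilate t z) = t ^+ d * f z) ->
  z.2 0 ord0 * ydiff ord0 f z + z.2 0 ord_max * ydiff ord_max f z
  = d%:R * f z.
Proof.
move=> Hf Oz fS.
pose e i : coords := (0, delta_mx 0 i).
pose y : coords := (0, z.2).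
have yE : y = z.2 0 ord0 *: e ord0 + z.2 0 ord_max *: e ord_max.
  rewrite /y /e [RHS]surjective_pairing /=; congr (_, _); first by rewrite !scaler0 addr0.
  apply/rowP => j; rewrite !mxE /=.
  by case: (ord2P j) => -> /=; rewrite ?mulr1 ?mulr0 ?addr0 ?add0r.
have D1 : is_derive (0 : R) 1 (fun r => f (r *: y + z)) ('D_y f z).
  apply: is_derive_line; rewrite scale0r add0r.
  by apply: derivableP; exact: smooth_on_derivable.
have D2 : is_derive (0 : R) 1 (fun r => (r + 1) ^+ d * f z) (d%:R * f z).
  have H : is_derive (0 : R) 1 ((fun r : R => r + 1) ^+ d) d%:R.
    by apply: is_derive_eq; rewrite addr0 /= add0r expr1n mulr1 [_ *: _]mulr1.
  have -> : (fun r : R => (r + 1) ^+ d * f z) =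
      ((fun r : R => r + 1) ^+ d) * cst (f z).
    by apply/funext => r; rewrite -[RHS]/(_ * _) exprfctE.
  have := is_deriveM H (is_derive_cst (f z) (0 : R) 1).
  by rewrite scaler0 add0r [_ *: _]mulrC.
have E : \forall r \near (0 : R), f (r *: y + z) = (r + 1) ^+ d * f z.
  near=> r; have r1 : 0 < r + 1.
    rewrite -ltrBlDr sub0r; near: r; apply: lt_nbhsr; by rewrite oppr_lt0.
  rewrite -fS//; congr f; rewrite /dilate/y [LHS]surjective_pairing /=.
  by congr (_, _); rewrite ?scaler0 ?add0r// scalerDl scale1r.
have [_ E1] := near_eq_is_derive E D1.
have [_ E2] := D2.
rewrite -E2 E1 yE (smooth_on_add_dir oO _ _ Hf)// !(smooth_on_scale_dir _ _ Hf)//.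
by rewrite /ydiff /e ![_ * z.2 _ _]mulrC.
Unshelve. all: by end_near. Qed.

End CoordinateCalculus.

Local Ltac smooth :=
  solve [repeat first [assumption
  | match goal with H : forall a : 'I_2, smooth_on _ _ |- _ => exact: H end
  | lazymatch goal with
  | |- smooth_on _ (fun w => @?a w + @?b w) => apply: smooth_onD
  | |- smooth_on _ (fun w => - @?a w) => apply: smooth_onN
  | |- smooth_on _ (fun w => @?a w * @?b w) => apply: smooth_onM
  | |- smooth_on _ (fun w => @?a w ^+ ?n) => apply: smooth_onX
  | |- smooth_on _ (fun w => expR (@?a w)) => apply: smooth_on_expR
  | |- smooth_on _ (fun w => ydiff ?i ?f w) => apply: smooth_on_ydiff
  | |- smooth_on _ (ydiff ?i ?f) => apply: smooth_on_ydiff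
  | |- smooth_on _ (fun w => @fun_of_matrix _ _ _ (snd w) _ _) => apply: smooth_on_fibre_coord
  | |- smooth_on _ (fun=> _) => apply: smooth_on_cst
  end]].

(* ring and field are fast only once the derivatives have become variables. *)
Local Ltac abstract_atoms :=
  repeat match goal with
  | |- context [@fun_of_matrix ?R ?m ?n (snd ?z) ?i ?j] =>
      generalize (@fun_of_matrix R m n (snd z) i j); intro
  end;
  repeat match goal with
  | |- context [?f ?w] => is_var w;
      lazymatch type of w with prod _ _ => generalize (f w); intro end
  end.
Local Ltac ring_atoms := abstract_atoms; ring.
Local Ltac field_atoms := abstract_atoms; field.

(** * The modified Berwald frame *)

Section ModifiedFrame.
Context {R : realType}.
Local Notation coords := ('rV[R]_2 * 'rV[R]_2)%type.
Variable O : set coords.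
Hypothesis oO : open O.
Hypothesis dilO : forall z (t : R), O z -> 0 < t -> O (dilate t z).
Implicit Types (f g : coords -> R) (z : coords) (i j k : 'I_2) (t c : R).

(** Compares the goal with the Leibniz expansion term by term, so the right-hand sides proved with
    it are kept in unreduced product-rule form. *)
Ltac derive_y :=
  repeat lazymatch goal with
  | |- ydiff _ (fun w => @?a w + @?b w) _ = _ =>
      refine (etrans (ydiffD (O := O) _ _ _ _) _); [smooth|smooth|eassumption|congr (_ + _)]
  | |- ydiff _ (fun w => - @?a w) _ = _ =>
      refine (etrans (ydiffN (O := O) _ _ _) _); [smooth|eassumption|congr (- _)]
  | |- ydiff _ (fun w => @?a w * @?b w) _ = _ =>
      refine (etrans (ydiffM (O := O) _ _ _ _) _); [smooth|smooth|eassumption|congr (_ * _ + _ * _)]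
  end.

(** The class to which the rule F d_i f = f_{;2} m_i applies. It contains the components of the
    frame and is stable under f_{;2}, so the rule can be iterated. *)
Definition smooth0 f :=
  smooth_on O f /\ forall z t, O z -> 0 < t -> f (dilate t z) = f z.

Lemma smooth0_smooth f : smooth0 f -> smooth_on O f. Proof. by case. Qed.

Lemma smooth0_ext f g : (forall z, O z -> f z = g z) -> smooth0 f -> smooth0 g.
Proof.
move=> fg [sf hf]; split; first exact: smooth_on_ext fg sf.
by move=> z t Oz t0; rewrite -!fg ?hf//; exact: dilO.
Qed.

Lemma smooth0_cst c : smooth0 (fun=> c).
Proof. by split => //; smooth. Qed.

Lemma smooth0D f g : smooth0 f -> smooth0 g -> smooth0 (fun z => f z + g z).
Proof.
by move=> [sf hf] [sg hg]; split => [|z t Oz t0]; [smooth|rewrite hf ?hg].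
Qed.

Lemma smooth0M f g : smooth0 f -> smooth0 g -> smooth0 (fun z => f z * g z).
Proof.
by move=> [sf hf] [sg hg]; split => [|z t Oz t0]; [smooth|rewrite hf ?hg].
Qed.

Lemma smooth0N f : smooth0 f -> smooth0 (fun z => - f z).
Proof. by move=> [sf hf]; split => [|z t Oz t0]; [smooth|rewrite hf]. Qed.

Lemma smooth0B f g : smooth0 f -> smooth0 g -> smooth0 (fun z => f z - g z).
Proof. by move=> sf sg; exact: smooth0D sf (smooth0N sg). Qed.

Lemma smooth0V f : (forall z, O z -> f z != 0) -> smooth0 f ->
  smooth0 (fun z => (f z)^-1).
Proof.
move=> f0 [sf hf]; split => [|z t Oz t0]; last by rewrite hf.
exact: smooth_onV.
Qed.

Lemma smooth0_sqrt f : (forall z, O z -> 0 < f z) -> smooth0 f ->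
  smooth0 (fun z => Num.sqrt (f z)).
Proof.
move=> f0 [sf hf]; split => [|z t Oz t0]; last by rewrite hf.
exact: smooth_on_sqrt.
Qed.

Lemma smooth0_euler f z : smooth0 f -> O z ->
  z.2 0 ord0 * ydiff ord0 f z + z.2 0 ord_max * ydiff ord_max f z = 0.
Proof.
move=> [sf hf] Oz; rewrite (euler_ydiff (d := 0) oO sf Oz) ?mul0r// => t t0.
by rewrite expr0 mul1r hf.
Qed.

Lemma g_E f i j z : smooth_on O f -> O z ->
  g_ f i j z = ydiff i f z * ydiff j f z + f z * ydiff i (ydiff j f) z.
Proof.
move=> sf Oz; rewrite /g_.
rewrite (@eq_ydiff _ _ oO i _ (fun w => 2 * (f w * ydiff j f w)))//; last first.
  by move=> w Ow; rewrite (ydiffX2 oO)//; ring_atoms.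
rewrite (ydiffM (O := O)); [|smooth..].
by rewrite ydiff_cst (ydiffM (O := O)); [field_atoms|smooth..].
Qed.

(** * The metric of [F] and its frame *)

Variable F : coords -> R.
Hypothesis F_smooth : smooth_on O F.
Hypothesis F_dilate : forall z t, O z -> 0 < t -> F (dilate t z) = t * F z.
Hypothesis F_neq0 : forall z, O z -> F z != 0.
Hypothesis F_det : forall z, O z -> \det (g_mx F z) != 0.

Lemma finsler_euler z : O z ->
  z.2 0 ord0 * ydiff ord0 F z + z.2 0 ord_max * ydiff ord_max F z = F z.
Proof.
move=> Oz; rewrite (euler_ydiff (d := 1) oO F_smooth Oz) ?mul1r// => t t0.
by rewrite expr1 F_dilate.
Qed.

Lemma smooth0_ell i : smooth0 (ydiff i F).
Proof.
split; first by smooth.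
move=> z t Oz t0; apply: (mulfI (lt0r_neq0 t0)).
by apply: (ydiff_dilate oO dilO) => // w Ow; exact: F_dilate.
Qed.

(** A vertical derivative lowers the degree by one and the factor F restores it. *)
Lemma smooth0_Fydiff f i : smooth0 f -> smooth0 (fun z => F z * ydiff i f z).
Proof.
move=> [sf hf]; split; first by smooth.
move=> z t Oz t0; rewrite F_dilate// mulrAC mulrC; congr (_ * _).
rewrite -[RHS]mul1r; apply: (ydiff_dilate oO dilO) => // w Ow.
by rewrite mul1r; exact: hf.
Qed.

(** Contraction on the inner index, obtained by differentiating y^i d_i F = F. Contraction on the
    outer index is Euler's relation for the degree-0 functions d_i F. *)
Lemma hessian_annihilates j z : O z ->
  z.2 0 ord0 * ydiff j (ydiff ord0 F) z
  + z.2 0 ord_max * ydiff j (ydiff ord_max F) z = 0.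
Proof.
move=> Oz; have Dy a : ydiff j (fun w : coords => w.2 0 a * ydiff a F w) z =
    (j == a)%:R * ydiff a F z + z.2 0 a * ydiff j (ydiff a F) z.
  by rewrite -[(j == a)%:R](ydiff_fibre_coord _ _ z); apply: (ydiffM (O := O)); smooth.
have E := eq_ydiff oO j finsler_euler Oz.
have {}E := etrans (esym (ydiffD (O := O) _ _ _ Oz)) E.
have {}E := etrans (esym (f_equal2 +%R (Dy ord0) (Dy ord_max))) (E _ _).
have {}E := E ltac:(smooth) ltac:(smooth).
apply: (addrI (ydiff j F z)); rewrite addr0 -[RHS]E.
by case: (ord2P j) => -> /=; ring_atoms.
Qed.

Let eps := signature F.
Let D z := \det (g_mx F z).
Let r z := Num.sqrt (eps z * D z).
Let m i z := m_low eps F i z.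

Lemma g_mx_det f z : \det (g_mx f z) =
  g_ f ord0 ord0 z * g_ f ord_max ord_max z
  - g_ f ord0 ord_max z * g_ f ord_max ord0 z.
Proof. by rewrite det_mx2 !mxE. Qed.

Lemma smooth0_g i j : smooth0 (g_ F i j).
Proof.
apply: (@smooth0_ext (fun z => ydiff i F z * ydiff j F z
    + F z * ydiff i (ydiff j F) z)) => [z Oz|]; first by rewrite g_E.
apply: smooth0D; first by apply: smooth0M; exact: smooth0_ell.
by apply: smooth0_Fydiff; exact: smooth0_ell.
Qed.

Lemma smooth0_det : smooth0 D.
Proof.
apply: (@smooth0_ext (fun z => g_ F ord0 ord0 z * g_ F ord_max ord_max z
  - g_ F ord0 ord_max z * g_ F ord_max ord0 z)) => [z Oz|].
  by rewrite /D g_mx_det.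
by apply: smooth0B; apply: smooth0M; exact: smooth0_g.
Qed.

Lemma signature_sqr z : O z -> eps z * eps z = 1.
Proof. by move=> Oz; rewrite -expr2 /eps /signature sqr_sg F_det. Qed.

Lemma signature_det_gt0 z : O z -> 0 < eps z * D z.
Proof. by move=> Oz; rewrite /eps /signature -normrEsg normr_gt0 F_det. Qed.

Lemma sqrt_det_gt0 z : O z -> 0 < r z.
Proof. by move=> Oz; rewrite sqrtr_gt0 signature_det_gt0. Qed.

Lemma sqrt_det_neq0 z : O z -> r z != 0.
Proof. by move=> Oz; rewrite gt_eqF// sqrt_det_gt0. Qed.

Lemma det_sqrt z : O z -> D z = eps z * r z ^+ 2.
Proof.
move=> Oz; rewrite sqr_sqrtr ?ltW ?signature_det_gt0//.
by rewrite mulrA signature_sqr// mul1r.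
Qed.

(* sg x = x / sqrt (x * x) exhibits the signature as a smooth function. *)
Lemma smooth0_signature : smooth0 eps.
Proof.
have DD0 z (Oz : O z) : 0 < D z * D z by rewrite -expr2 exprn_even_gt0 //= F_det.
apply: (@smooth0_ext (fun z => D z * (Num.sqrt (D z * D z))^-1)) => [z Oz|].
  rewrite -expr2 sqrtr_sqr /eps /signature; have := F_det Oz.
  rewrite -/(D z); case: sgrP => // [|] D0 _; first by rewrite divff ?gt_eqF.
  by rewrite invrN mulrN divff ?lt_eqF.
apply: smooth0M; first exact: smooth0_det.
apply: smooth0V; first by move=> z Oz; rewrite gt_eqF// sqrtr_gt0 DD0.
apply: smooth0_sqrt; first exact: DD0.
by apply: smooth0M; exact: smooth0_det.
Qed.

(** Differentiating eps^2 = 1 gives 2 eps d_i eps = 0. *)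
Lemma ydiff_signature i z : O z -> ydiff i eps z = 0.
Proof.
move=> Oz; have se := smooth0_smooth smooth0_signature.
have := eq_ydiff oO i signature_sqr Oz; rewrite ydiff_cst (ydiffM (O := O))// => E.
have e2 : 2 * eps z != 0.
  rewrite mulf_neq0 ?pnatr_eq0//; apply: contra_eqN (signature_sqr Oz).
  by move=> /eqP ->; rewrite mul0r eq_sym oner_eq0.
by apply: (mulfI e2); rewrite mulr0 -E; ring_atoms.
Qed.

Lemma smooth0_sqrt_det : smooth0 r.
Proof.
apply: smooth0_sqrt; first exact: signature_det_gt0.
by apply: smooth0M; [exact: smooth0_signature|exact: smooth0_det].
Qed.

Lemma m_low0 z : m ord0 z = r z * (- z.2 0 ord_max * (F z)^-1).
Proof. by rewrite mulNr mulrN. Qed.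

Lemma m_low1 z : m ord_max z = r z * (z.2 0 ord0 * (F z)^-1).
Proof. by []. Qed.

Lemma smooth0_m i : smooth0 (m i).
Proof.
have sl j : smooth0 (fun z => z.2 0 j * (F z)^-1).
  split; first by apply: smooth_onM; [|smooth|exact: smooth_onV].
  move=> z t Oz t0; rewrite F_dilate//= !mxE invfM mulrACA divff ?gt_eqF//.
  by rewrite mul1r.
have sm j : smooth0 (fun z => r z * (z.2 0 j * (F z)^-1)).
  by apply: smooth0M; [exact: smooth0_sqrt_det|exact: sl].
by case: (ord2P i) => ->; [exact: smooth0N (sm ord_max)|exact: sm ord0].
Qed.

Lemma ell_m_area z : O z ->
  ydiff ord0 F z * m ord_max z - ydiff ord_max F z * m ord0 z = r z.
Proof.
move=> Oz; have Fz := F_neq0 Oz.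
rewrite m_low0 m_low1; apply: (mulIf Fz).
transitivity (r z * (z.2 0 ord0 * ydiff ord0 F z
    + z.2 0 ord_max * ydiff ord_max F z)).
  by move: Fz; abstract_atoms => Fz; field.
by rewrite finsler_euler.
Qed.

(** With nu = (- y^2, y^1), [null_form_det] gives F^3 d_i d_j F = det g nu_i nu_j; now m_i = r nu_i
    / F and det g = eps r^2. *)
Lemma hessian_m i j z : O z ->
  F z * ydiff i (ydiff j F) z = eps z * m i z * m j z.
Proof.
move=> Oz; have Fz := F_neq0 Oz.
have [] := @null_form_det _ (z.2 0 ord0) (z.2 0 ord_max) (ydiff ord0 F z)
  (ydiff ord_max F z) (F z) _ _ _ _ (D z) Fz (finsler_euler Oz)
  (smooth0_euler (smooth0_ell ord0) Oz) (smooth0_euler (smooth0_ell ord_max) Oz)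
  (hessian_annihilates ord0 Oz) (hessian_annihilates ord_max Oz).
  by rewrite /D g_mx_det !g_E//; ring_atoms.
rewrite (det_sqrt Oz) => h00 h01 h10 h11.
have alg (f e s a b h : R) : f != 0 -> f ^+ 3 * h = e * s ^+ 2 * a * b ->
    f * h = e * (s * (a * f^-1)) * (s * (b * f^-1)).
  move=> f0 E; apply: (mulfI (expf_neq0 2 f0)).
  by transitivity (f ^+ 3 * h); [ring|rewrite E; field].
by case: (ord2P i) => ->; case: (ord2P j) => ->; rewrite ?m_low0 ?m_low1; exact: (alg _ _ _ _ _ _ Fz).
Qed.

Lemma g_m i j z : O z ->
  g_ F i j z = ydiff i F z * ydiff j F z + eps z * m i z * m j z.
Proof. by move=> Oz; rewrite g_E// hessian_m. Qed.

(** The vector (eps / r) (- l_2, l_1) is annihilated by l and pairs with m to eps, by [ell_m_area];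
    hence l l + eps m m lowers it to eps^2 m = m. *)
Lemma m_upE z : O z ->
  m_up eps F ord0 z = - (eps z / r z * ydiff ord_max F z) /\
  m_up eps F ord_max z = eps z / r z * ydiff ord0 F z.
Proof.
move=> Oz; have rz := sqrt_det_neq0 Oz.
pose v i := if i == ord0 then - (eps z / r z * ydiff ord_max F z)
  else eps z / r z * ydiff ord0 F z.
have H i : m_up eps F i z = v i.
  apply: (invmx_solve (M := g_mx F z)) => [|{}i]; first exact: F_det.
  rewrite sum_ord2 !mxE !g_m// /v /=.
  transitivity (eps z * eps z * m i z / r z
    * (ydiff ord0 F z * m ord_max z - ydiff ord_max F z * m ord0 z)).
    by move: rz; abstract_atoms => rz; field.
  by rewrite ell_m_area// signature_sqr// mul1r divfK.
by rewrite !H.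
Qed.

Lemma m_up_ell z : O z ->
  ydiff ord0 F z * m_up eps F ord0 z + ydiff ord_max F z * m_up eps F ord_max z
  = 0.
Proof. by move=> Oz; have [-> ->] := m_upE Oz; ring_atoms. Qed.

Lemma m_up_m z : O z ->
  m ord0 z * m_up eps F ord0 z + m ord_max z * m_up eps F ord_max z = eps z.
Proof.
move=> Oz; have [-> ->] := m_upE Oz; have rz := sqrt_det_neq0 Oz.
rewrite -[RHS](mulfK rz) -(ell_m_area Oz).
by rewrite [RHS]mulrAC; ring_atoms.
Qed.

(** The eps in the definition of f_{;2} cancels the one in m^i. What is left is built from degree-0
    functions only, which is how f_{;2} is seen to be of degree 0. *)
Lemma vder2E f z : O z -> vder2 F f z =
  (r z)^-1 * (ydiff ord0 F z * (F z * ydiff ord_max f z)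
    - ydiff ord_max F z * (F z * ydiff ord0 f z)).
Proof.
move=> Oz; rewrite /vder2 sum_ord2; have [-> ->] := m_upE Oz.
transitivity (eps z * eps z * ((r z)^-1 * (ydiff ord0 F z * (F z * ydiff ord_max f z)
    - ydiff ord_max F z * (F z * ydiff ord0 f z)))); first by rewrite /eps; ring_atoms.
by rewrite signature_sqr// mul1r.
Qed.

Lemma smooth0_vder2 f : smooth0 f -> smooth0 (vder2 F f).
Proof.
move=> sf; apply: smooth0_ext (fun z Oz => esym (vder2E f Oz)) _.
apply: smooth0M.
  by apply: smooth0V; [exact: sqrt_det_neq0|exact: smooth0_sqrt_det].
by apply: smooth0B; apply: smooth0M;
  [exact: smooth0_ell|exact: smooth0_Fydiff|exact: smooth0_ell|exact: smooth0_Fydiff].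
Qed.

Lemma ydiff_vder2 f i z : smooth0 f -> O z ->
  F z * ydiff i f z = vder2 F f z * m i z.
Proof.
move=> sf Oz; have Fz := F_neq0 Oz; have rz := sqrt_det_neq0 Oz.
have E := smooth0_euler sf Oz; have FE := finsler_euler Oz.
(* The factor F on the left is expanded as y^j l_j; Euler's relation for f then trades y^1 d_1 f for
   - y^2 d_2 f, or conversely. *)
rewrite vder2E//; case: (ord2P i) => ->; rewrite ?m_low0 ?m_low1 -{1}FE.
  transitivity ((z.2 0 ord0 * ydiff ord0 f z) * ydiff ord0 F z
    + z.2 0 ord_max * ydiff ord_max F z * ydiff ord0 f z); first by ring_atoms.
  have -> : z.2 0 ord0 * ydiff ord0 f z = - (z.2 0 ord_max * ydiff ord_max f z).
    by apply/eqP; rewrite -subr_eq0 opprK E.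
  by move: Fz rz; abstract_atoms => Fz rz; field; rewrite Fz rz.
transitivity ((z.2 0 ord_max * ydiff ord_max f z) * ydiff ord_max F z
    + z.2 0 ord0 * ydiff ord0 F z * ydiff ord_max f z); first by ring_atoms.
have -> : z.2 0 ord_max * ydiff ord_max f z = - (z.2 0 ord0 * ydiff ord0 f z).
  by apply/eqP; rewrite -subr_eq0 opprK addrC E.
by move: Fz rz; abstract_atoms => Fz rz; field; rewrite Fz rz.
Qed.


Lemma m_neq0 z : O z -> exists i, m i z != 0.
Proof.
move=> Oz; have [m0|] := eqVneq (m ord0 z) 0; last by exists ord0.
exists ord_max; apply: contra_neq (sqrt_det_neq0 Oz) => m1.
by rewrite -(ell_m_area Oz) m0 m1; ring_atoms.
Qed.

(** * The main scalar *)

Let I z := eps z * (vder2 F r z / r z).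

Lemma smooth0_I : smooth0 I.
Proof.
apply: smooth0M; first exact: smooth0_signature.
apply: smooth0M; first exact: smooth0_vder2 smooth0_sqrt_det.
by apply: smooth0V; [exact: sqrt_det_neq0|exact: smooth0_sqrt_det].
Qed.

Lemma ydiff_m i k z : O z ->
  F z * ydiff k (m i) z = (- ydiff i F z + eps z * I z * m i z) * m k z.
Proof.
move=> Oz; have Fz := F_neq0 Oz; have rz := sqrt_det_neq0 Oz.
have sr := smooth0_smooth smooth0_sqrt_det.
have Er := ydiff_vder2 k smooth0_sqrt_det Oz.
have eI : eps z * I z = vder2 F r z / r z by rewrite mulrA signature_sqr ?mul1r.
have dV : ydiff k (fun w => (F w)^-1) z = - (ydiff k F z / F z ^+ 2).
  exact: (ydiffV (O := O)).
have sV : smooth_on O (fun w => (F w)^-1) by exact: smooth_onV.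
(* Here [n] is nu_i and [dn] is d_k nu_i. The derivative of r yields the I term; [frame], an
   instance of Euler's relation, yields - l_i m_k. *)
suff [n [dn [mE dm frame]]] : exists n dn, [/\ m i z = r z * (n * (F z)^-1),
    ydiff k (m i) z = ydiff k r z * (n * (F z)^-1)
      + r z * (dn * (F z)^-1 + n * - (ydiff k F z / F z ^+ 2)) &
    r z * (dn - n * ydiff k F z / F z) = - ydiff i F z * m k z].
  rewrite dm mulrDl -frame eI mE.
  transitivity ((F z * ydiff k r z) * (n * (F z)^-1)
     + r z * (dn - n * ydiff k F z / F z)).
    by move: Fz; abstract_atoms => Fz; field.
  by rewrite Er; move: Fz rz; abstract_atoms => Fz rz; field; rewrite Fz rz.
have dy j : ydiff k (fun w : coords => w.2 0 j) z = (k == j)%:R.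
  exact: ydiff_fibre_coord.
case: (ord2P i) => ->.
  exists (- z.2 0 ord_max), (- (k == ord_max)%:R); split; first exact: m_low0.
    rewrite (eq_ydiff oO _ (fun w _ => m_low0 w) Oz).
    rewrite -dV -dy -(ydiffN (O := O)); [|smooth..].
    by derive_y.
  move: Fz; rewrite -(finsler_euler Oz).
  case: (ord2P k) => -> /=; rewrite ?m_low0 ?m_low1 -(finsler_euler Oz);
    by abstract_atoms => Fz; field.
exists (z.2 0 ord0), (k == ord0)%:R; split; first exact: m_low1.
  rewrite (eq_ydiff oO _ (fun w _ => m_low1 w) Oz).
  rewrite -dV -dy.
  by derive_y.
move: Fz; rewrite -(finsler_euler Oz).
case: (ord2P k) => -> /=; rewrite ?m_low0 ?m_low1 -(finsler_euler Oz);
  by abstract_atoms => Fz; field.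
Qed.

(** In the derivative of l_i l_j + eps m_i m_j the terms containing l cancel between the Hessian of
    F and the - l_i m_k part of d_k m_i. Two equal terms eps^2 I m_i m_j m_k remain. *)
Lemma cartan_m i j k z : O z ->
  F z * cartan F i j k z = I z * m i z * m j z * m k z.
Proof.
move=> Oz; have se := smooth0_smooth smooth0_signature.
have sm a := smooth0_smooth (smooth0_m a).
rewrite /cartan (eq_ydiff oO k (fun w => @g_m i j w) Oz).
have -> : ydiff k (fun w => ydiff i F w * ydiff j F w + eps w * m i w * m j w) z
    = ydiff k (ydiff i F) z * ydiff j F z + ydiff i F z * ydiff k (ydiff j F) z
      + ((ydiff k eps z * m i z + eps z * ydiff k (m i) z) * m j z
        + eps z * m i z * ydiff k (m j) z) by derive_y.
rewrite ydiff_signature// mul0r add0r.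
transitivity (2^-1 * ((F z * ydiff k (ydiff i F) z) * ydiff j F z
  + ydiff i F z * (F z * ydiff k (ydiff j F) z)
  + eps z * (F z * ydiff k (m i) z) * m j z
  + eps z * m i z * (F z * ydiff k (m j) z))); first by ring_atoms.
move: (hessian_m k i Oz) (hessian_m k j Oz) (ydiff_m i k Oz) (ydiff_m j k Oz)
  (signature_sqr Oz).
abstract_atoms => -> -> -> -> e2.
rewrite -[RHS]mulr1 -[X in _ = _ * X]e2.
by field.
Qed.

(** The value [c] shows that [xget] does not return its default, and cancelling a nonzero m_i three
    times in the component iii forces the chosen value. *)
Lemma main_scalar_unique e f z c : (exists i, m_low e f i z != 0) ->
  (forall i j k, f z * cartan f i j k z
    = c * m_low e f i z * m_low e f j z * m_low e f k z) ->
  main_scalar e f z = c.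
Proof.
move=> [i mi] H; rewrite /main_scalar; case: xgetP => [t _ Ht|/(_ c)/(_ H)//].
have := Ht i i i; rewrite H => /(mulIf mi)/(mulIf mi)/(mulIf mi) ->.
by [].
Qed.

Lemma main_scalarE z : O z -> main_scalar eps F z = I z.
Proof.
move=> Oz; apply: main_scalar_unique; first exact: m_neq0.
by move=> i j k; exact: cartan_m.
Qed.

Lemma cartan_main_scalar i j k z : O z ->
  F z * cartan F i j k z = main_scalar eps F z * m i z * m j z * m k z.
Proof. by move=> Oz; rewrite main_scalarE//; exact: cartan_m. Qed.

(** * The conformal change *)

Variable phi : coords -> R.
Hypothesis phi_smooth0 : smooth0 phi.

Let G := conformal F phi.
Let E z := expR (phi z).
Let phi2 := vder2 F phi.
Let sigma := sigma_ F phi.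
(** The reciprocal of rho; it keeps the covariant formulas polynomial. *)
Let W z := sigma z + eps z - phi2 z ^+ 2.

Lemma smooth0_phi2 : smooth0 phi2.
Proof. exact: smooth0_vder2. Qed.

Lemma sigmaE z : O z -> sigma z =
  vder2 F phi2 z + eps z * I z * phi2 z + 2 * (phi2 z * phi2 z).
Proof. by move=> Oz; rewrite -main_scalarE. Qed.

Lemma smooth0_sigma : smooth0 sigma.
Proof.
apply: smooth0_ext (fun z Oz => esym (sigmaE Oz)) _.
have s2 := smooth0_phi2.
exact: smooth0D (smooth0D (smooth0_vder2 s2)
    (smooth0M (smooth0M smooth0_signature smooth0_I) s2))
  (smooth0M (smooth0_cst 2) (smooth0M s2 s2)).
Qed.

Lemma smooth_conformal : smooth_on O G.
Proof.
have sp := smooth0_smooth phi_smooth0.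
change (smooth_on O (fun z => expR (phi z) * F z)); smooth.
Qed.

Lemma ydiff_conformal j z : O z ->
  ydiff j G z = E z * (ydiff j F z + phi2 z * m j z).
Proof.
move=> Oz; have sp := smooth0_smooth phi_smooth0.
transitivity (E z * ydiff j phi z * F z + E z * ydiff j F z).
  change (ydiff j (fun w => expR (phi w) * F w) z =
    expR (phi z) * ydiff j phi z * F z + expR (phi z) * ydiff j F z).
  by rewrite -(ydiff_expR (O := O)); [derive_y|smooth..].
transitivity (E z * (F z * ydiff j phi z) + E z * ydiff j F z).
  by ring_atoms.
move: (ydiff_vder2 j phi_smooth0 Oz : F z * ydiff j phi z = phi2 z * m j z).
by abstract_atoms => ->; ring.
Qed.

(** The terms phi_{;2} l_j m_i coming from e^phi and from d_i m_j cancel. The remaining coefficient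
    of m_i m_j is phi_{;2;2} + eps I phi_{;2} + phi_{;2}^2 + eps, which explains the definition of
    sigma. *)
Lemma hessian_conformal i j z : O z ->
  F z * ydiff i (ydiff j G) z = E z * W z * m i z * m j z.
Proof.
move=> Oz; have sp := smooth0_smooth phi_smooth0.
have s2 := smooth0_smooth smooth0_phi2.
have sm a := smooth0_smooth (smooth0_m a).
have sE : smooth_on O E by exact: smooth_on_expR.
rewrite (eq_ydiff oO i (ydiff_conformal j) Oz).
have -> : ydiff i (fun w => E w * (ydiff j F w + phi2 w * m j w)) z =
    ydiff i E z * (ydiff j F z + phi2 z * m j z)
    + E z * (ydiff i (ydiff j F) z
      + (ydiff i phi2 z * m j z + phi2 z * ydiff i (m j) z)) by derive_y.
have -> : ydiff i E z = E z * ydiff i phi z by exact: ydiff_expR.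
transitivity (E z * ((F z * ydiff i phi z) * (ydiff j F z + phi2 z * m j z)
    + (F z * ydiff i (ydiff j F) z
      + (F z * ydiff i phi2 z * m j z + phi2 z * (F z * ydiff i (m j) z))))).
  by ring_atoms.
move: (hessian_m i j Oz) (ydiff_m j i Oz) (ydiff_vder2 i smooth0_phi2 Oz)
  (ydiff_vder2 i phi_smooth0 Oz : F z * ydiff i phi z = phi2 z * m i z)
  (sigmaE Oz).
rewrite /W; abstract_atoms => -> -> -> -> ->.
by ring.
Qed.

Lemma g_conformal i j z : O z -> g_ G i j z = E z * E z *
  ((ydiff i F z + phi2 z * m i z) * (ydiff j F z + phi2 z * m j z)
   + W z * m i z * m j z).
Proof.
move=> Oz; rewrite g_E ?ydiff_conformal//; last exact: smooth_conformal.
have -> : G z * ydiff i (ydiff j G) z = E z * (F z * ydiff i (ydiff j G) z).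
  by rewrite mulrA.
rewrite (hessian_conformal i j Oz).
by ring_atoms.
Qed.

(** All terms containing l cancel, leaving the coefficient e^(2 phi) (2 phi_{;2} W + W_{;2} / 2 +
    eps I W). After W is expanded and phi_{;2;2} is eliminated through sigma, the terms phi_{;2}^3
    and eps I phi_{;2}^2 cancel too. *)
Lemma cartan_conformal i j k z : O z ->
  F z * cartan G i j k z = E z * E z
    * (main_scalar eps F z * (1 + eps z * sigma z) + 2^-1 * vder2 F sigma z
       + phi2 z * (sigma z + 2 * eps z)) * m i z * m j z * m k z.
Proof.
move=> Oz; have sp := smooth0_smooth phi_smooth0.
have s2 := smooth0_smooth smooth0_phi2.
have ss := smooth0_smooth smooth0_sigma.
have se := smooth0_smooth smooth0_signature.
have sm a := smooth0_smooth (smooth0_m a).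
have sE : smooth_on O E by exact: smooth_on_expR.
rewrite main_scalarE// /cartan (eq_ydiff oO k (fun w => @g_conformal i j w) Oz).
have -> : ydiff k (fun w => E w * E w *
  ((ydiff i F w + phi2 w * m i w) * (ydiff j F w + phi2 w * m j w)
   + W w * m i w * m j w)) z =
  (ydiff k E z * E z + E z * ydiff k E z) *
  ((ydiff i F z + phi2 z * m i z) * (ydiff j F z + phi2 z * m j z)
   + W z * m i z * m j z)
  + E z * E z *
  ((ydiff k (ydiff i F) z + (ydiff k phi2 z * m i z + phi2 z * ydiff k (m i) z))
      * (ydiff j F z + phi2 z * m j z)
   + (ydiff i F z + phi2 z * m i z) * (ydiff k (ydiff j F) z
      + (ydiff k phi2 z * m j z + phi2 z * ydiff k (m j) z))
   + (((ydiff k sigma z + ydiff k eps z - 2 * phi2 z * ydiff k phi2 z) * m i z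
      + W z * ydiff k (m i) z) * m j z + W z * m i z * ydiff k (m j) z)).
  have -> : ydiff k sigma z + ydiff k eps z - 2 * phi2 z * ydiff k phi2 z =
      ydiff k W z.
    rewrite -(ydiffX2 oO)//; apply: esym.
    by change (ydiff k (fun w => sigma w + eps w - phi2 w ^+ 2) z =
      ydiff k sigma z + ydiff k eps z - ydiff k (fun w => phi2 w ^+ 2) z);
      derive_y.
  have sW : smooth_on O W.
    change (smooth_on O (fun w => sigma w + eps w - phi2 w ^+ 2)); smooth.
  by derive_y.
have -> : ydiff k E z = E z * ydiff k phi z by exact: ydiff_expR.
rewrite ydiff_signature// addr0.
transitivity (2^-1 * (2 * (E z * E z * (F z * ydiff k phi z)) *
  ((ydiff i F z + phi2 z * m i z) * (ydiff j F z + phi2 z * m j z)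
   + W z * m i z * m j z)
  + E z * E z *
  ((F z * ydiff k (ydiff i F) z
       + (F z * ydiff k phi2 z * m i z + phi2 z * (F z * ydiff k (m i) z)))
      * (ydiff j F z + phi2 z * m j z)
   + (ydiff i F z + phi2 z * m i z) * (F z * ydiff k (ydiff j F) z
      + (F z * ydiff k phi2 z * m j z + phi2 z * (F z * ydiff k (m j) z)))
   + ((F z * ydiff k sigma z - 2 * phi2 z * (F z * ydiff k phi2 z)) * m i z * m j z
      + W z * (F z * ydiff k (m i) z) * m j z
      + W z * m i z * (F z * ydiff k (m j) z))))).
  by ring_atoms.
have phi22 : vder2 F phi2 z =
    sigma z - eps z * I z * phi2 z - 2 * (phi2 z * phi2 z).
  by move: (sigmaE Oz); abstract_atoms => ->; ring.
(* The summand I of I (1 + eps sigma) arises as eps^2 I, from the eps contained in W. *)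
transitivity (E z * E z
    * (eps z * eps z * I z + I z * (eps z * sigma z) + 2^-1 * vder2 F sigma z
       + phi2 z * (sigma z + 2 * eps z)) * m i z * m j z * m k z).
  move: (hessian_m k i Oz) (hessian_m k j Oz) (ydiff_m i k Oz) (ydiff_m j k Oz)
    (ydiff_vder2 k phi_smooth0 Oz : F z * ydiff k phi z = phi2 z * m k z)
    (ydiff_vder2 k smooth0_phi2 Oz) (ydiff_vder2 k smooth0_sigma Oz) phi22.
  rewrite /W; abstract_atoms => -> -> -> -> -> -> -> ->.
  by field.
by move: (signature_sqr Oz); abstract_atoms => ->; ring.
Qed.


(** * Frame, main scalar and mixed Cartan tensor of the transformed metric *)

Let K z := main_scalar eps F z * (1 + eps z * sigma z) + 2^-1 * vder2 F sigma z
  + phi2 z * (sigma z + 2 * eps z).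

Lemma conformalE z : G z = E z * F z. Proof. by []. Qed.

(** With L = l + phi_{;2} m the metric is e^(2 phi) (L L + W m m), and L_1 m_2 - L_2 m_1 = l_1 m_2 -
    l_2 m_1 = r. *)
Lemma det_conformal z : O z -> \det (g_mx G z) = (E z * E z * r z) ^+ 2 * W z.
Proof.
move=> Oz; rewrite g_mx_det.
move: (g_conformal ord0 ord0 Oz) (g_conformal ord_max ord_max Oz)
  (g_conformal ord0 ord_max Oz) (g_conformal ord_max ord0 Oz) (ell_m_area Oz).
by abstract_atoms => -> -> -> -> <-; ring.
Qed.

(** The root of the determinant contributes e^(2 phi), and division by G takes one factor e^phi
    back. *)
Lemma m_low_conformal i z : O z ->
  m_low eps G i z = E z * Num.sqrt (eps z * W z) * m i z.
Proof.
move=> Oz.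
have S : Num.sqrt (eps z * \det (g_mx G z))
    = E z * E z * r z * Num.sqrt (eps z * W z).
  rewrite det_conformal// mulrCA sqrtrM ?sqr_ge0// sqrtr_sqr ger0_norm//.
  by rewrite !mulr_ge0 ?expR_ge0// ltW// sqrt_det_gt0.
have Fz := F_neq0 Oz; have Ez : E z != 0 by rewrite gt_eqF// expR_gt0.
case: (ord2P i) => ->; rewrite /m_low /= -/(m_low _ _ _ _) S /ell_up conformalE.
  rewrite m_low0; move: (Num.sqrt (eps z * W z)) Fz Ez => s.
  by abstract_atoms => Fz Ez; field; rewrite Fz Ez.
rewrite m_low1; move: (Num.sqrt (eps z * W z)) Fz Ez => s.
by abstract_atoms => Fz Ez; field; rewrite Fz Ez.
Qed.

(** With s = sqrt (eps W), both G times the new Cartan tensor and the cube of the new m carry e^(3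
    phi), so the scalar is K / s^3. As eps^-1 = eps, s^-2 = eps rho, whence the exponent 3/2. *)
Lemma main_scalar_conformal z : O z -> 0 < eps z * (W z)^-1 ->
  main_scalar eps G z = (eps z * (W z)^-1) `^ (3 / 2) * K z.
Proof.
move=> Oz eW.
have eVe : (eps z)^-1 = eps z.
  have e0 : eps z != 0.
    by apply: contra_eq_neq (signature_sqr Oz) => ->; rewrite mul0r eq_sym oner_eq0.
  by apply: (mulfI e0); rewrite divff// signature_sqr.
have eW' : 0 < eps z * W z by rewrite -invr_gt0 invfM eVe.
pose s := Num.sqrt (eps z * W z).
have s0 : 0 < s by rewrite sqrtr_gt0.
have eWs : eps z * (W z)^-1 = s^-1 ^+ 2.
  by rewrite exprVn sqr_sqrtr ?ltW// invfM eVe.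
have -> : (eps z * (W z)^-1) `^ (3 / 2) = s^-1 ^+ 3.
  have sV : 0 <= s^-1 by rewrite invr_ge0 ltW.
  rewrite eWs -powR_mulrn// -powRrM -[RHS]powR_mulrn//; congr (_ `^ _).
  by field.
have Ez : E z != 0 by rewrite gt_eqF// expR_gt0.
apply: main_scalar_unique.
  have [i mi] := m_neq0 Oz; exists i.
  by rewrite m_low_conformal// !mulf_neq0// gt_eqF.
move=> i j k; rewrite !m_low_conformal// -/s conformalE -mulrA cartan_conformal//.
rewrite -/(K z).
have sn : s != 0 by rewrite gt_eqF.
clearbody s; move: sn Ez.
by abstract_atoms => sn Ez; field.
Qed.

Lemma cartan_up_m i j k z : O z ->
  F z * cartan_up F i j k z = main_scalar eps F z * m_up eps F i z * m j z * m k z.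
Proof.
move=> Oz; rewrite /cartan_up /m_up !sum_ord2.
transitivity (g_inv F i ord0 z * (F z * cartan F ord0 j k z)
  + g_inv F i ord_max z * (F z * cartan F ord_max j k z)); first by ring_atoms.
rewrite -/(m ord0 z) -/(m ord_max z).
move: (cartan_main_scalar ord0 j k Oz) (cartan_main_scalar ord_max j k Oz).
by abstract_atoms => -> ->; ring.
Qed.

(** The vector m^i - eps phi_{;2} l^i is annihilated by l + phi_{;2} m and pairs with m to eps, so
    the new metric lowers it to a multiple of m. This is the source of the l^i term in (iii). *)
Lemma g_inv_conformal_m i z : O z -> W z != 0 ->
  \sum_(h < 2) g_inv G i h z * m h z = eps z * (W z)^-1 / (E z * E z)
    * (m_up eps F i z - eps z * phi2 z * ell_up F i z).
Proof.
move=> Oz Wz; have Fz := F_neq0 Oz.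
have Ez : E z != 0 by rewrite gt_eqF// expR_gt0.
apply: (invmx_solve (M := g_mx G z) (v := fun i => eps z * (W z)^-1 / (E z * E z)
    * (m_up eps F i z - eps z * phi2 z * ell_up F i z))) => [|{}i].
  by rewrite det_conformal// mulf_neq0// expf_neq0// !mulf_neq0// sqrt_det_neq0.
rewrite sum_ord2 !mxE (g_conformal i ord0 Oz) (g_conformal i ord_max Oz).
have l1 : ydiff ord0 F z * ell_up F ord0 z + ydiff ord_max F z * ell_up F ord_max z = 1.
  apply: (mulIf Fz); rewrite mul1r; move: Fz (finsler_euler Oz).
  by rewrite /ell_up; abstract_atoms => Fz FE; rewrite -[RHS]FE; field.
have l2 : m ord0 z * ell_up F ord0 z + m ord_max z * ell_up F ord_max z = 0.
  by rewrite /ell_up m_low0 m_low1; move: Fz; abstract_atoms => Fz; field.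
transitivity (eps z * (W z)^-1 * ((ydiff i F z + phi2 z * m i z)
   * ((ydiff ord0 F z * m_up eps F ord0 z + ydiff ord_max F z * m_up eps F ord_max z)
     + phi2 z * (m ord0 z * m_up eps F ord0 z + m ord_max z * m_up eps F ord_max z)
     - eps z * phi2 z * ((ydiff ord0 F z * ell_up F ord0 z + ydiff ord_max F z * ell_up F ord_max z)
       + phi2 z * (m ord0 z * ell_up F ord0 z + m ord_max z * ell_up F ord_max z)))
   + W z * m i z * ((m ord0 z * m_up eps F ord0 z + m ord_max z * m_up eps F ord_max z)
     - eps z * phi2 z * (m ord0 z * ell_up F ord0 z + m ord_max z * ell_up F ord_max z)))).
  by move: Ez Wz; abstract_atoms => Ez Wz; field; rewrite Ez Wz.
rewrite l1 l2 (m_up_ell Oz) (m_up_m Oz).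
transitivity (eps z * eps z * m i z).
  by move: Wz; abstract_atoms => Wz; field.
by rewrite (signature_sqr Oz) mul1r.
Qed.

Lemma cartan_up_conformal i j k z : O z -> W z != 0 ->
  F z * cartan_up G i j k z = eps z * (W z)^-1 * K z
    * (m_up eps F i z - eps z * phi2 z * ell_up F i z) * m j z * m k z.
Proof.
move=> Oz Wz; have Ez : E z != 0 by rewrite gt_eqF// expR_gt0.
transitivity (E z * E z * K z * (\sum_(h < 2) g_inv G i h z * m h z) * m j z * m k z).
  rewrite /cartan_up !sum_ord2.
  transitivity (g_inv G i ord0 z * (F z * cartan G ord0 j k z)
    + g_inv G i ord_max z * (F z * cartan G ord_max j k z)); first by ring_atoms.
  move: (cartan_conformal ord0 j k Oz) (cartan_conformal ord_max j k Oz).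
  by rewrite -/(K z); abstract_atoms => -> ->; ring.
rewrite (g_inv_conformal_m i Oz Wz).
by move: Wz Ez; abstract_atoms => Wz Ez; field; rewrite Wz Ez.
Qed.

End ModifiedFrame.

(** * From the tangent bundle to a chart *)

(** The fibre component is a directional derivative of a transition map, hence homogeneous in the
    direction. This carries homogeneity on TM over to induced coordinates. *)
Lemma of_coords_dilate (R : realType) (M : smooth_surface R)
    (a : chart_index M) (z : 'rV[R]_2 * 'rV[R]_2) (t : R) :
  (chart a @` chart_dom a) z.1 ->
  of_coords a (dilate t z) = tscale t (of_coords a z).
Proof.
move=> [p ap pz]; rewrite /of_coords /tscale /dilate /=; congr (_, _).
have pE : chart_inv a z.1 = p by rewrite -pz chartK.
set b := chart_at _.
(* The selected chart at p contains p, so the transition map is smooth at this point. *)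
have zab : (chart a @` (chart_dom a `&` chart_dom b)) z.1.
  by exists p => //; split => //; rewrite /b pE; exact: chart_atP.
have hd v : derivable (chart b \o chart_inv a) z.1 v.
  by have [_ /(_ v)[/(_ _ zab)]] := transition_smooth a b 1.
rewrite !derive_mx//; apply/rowP => j; rewrite !mxE.
have hj := (derivable_mxP _ _ _).1 (hd z.2) 0 j.
by have [_ ->] := is_derive_scale_dir t (derivableP hj); rewrite mulrC.
Qed.

Theorem proposition3p3 (R : realType) (M : smooth_surface R)
    (A : set (tangent_bundle M)) (F phi : tangent_bundle M -> R)
    (F_finsler : conic_pseudo_finsler A F)
    (F_neq0 : forall v, A v -> F v != 0)
    (phi_smooth : smooth_TM A phi)
    (phi_homogeneous : pos_homogeneous 0 A phi)
    (sigma_neq0 : forall a z, coord_dom A a z ->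
       sigma_ (coord_fun F a) (coord_fun phi a) z
       + signature (coord_fun F a) z
       - vder2 (coord_fun F a) (coord_fun phi a) z ^+ 2 != 0)
    (a : chart_index M) (z : 'rV[R]_2 * 'rV[R]_2)
    (z_dom : coord_dom A a z) :
  let Fa := coord_fun F a in
  let phia := coord_fun phi a in
  let Fbar := conformal Fa phia in
  let eps := signature Fa z in
  let rho := rho_ Fa phia z in
  let phi2 := vder2 Fa phia z in
  let sigma := sigma_ Fa phia z in
  let sigma2 := vder2 Fa (sigma_ Fa phia) z in
  let I := main_scalar (signature Fa) Fa z in
  let Ibar := main_scalar (signature Fa) Fbar z in
  let m i := m_low (signature Fa) Fa i z in
  let m' i := m_up (signature Fa) Fa i z in
  let ell' i := ell_up Fa i z in
  [/\ (* (i) *)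
      forall i j k : 'I_2,
        Fa z * cartan Fbar i j k z =
          expR (2 * phia z) * (Fa z * cartan Fa i j k z)
          + expR (2 * phia z)
            * (eps * I * sigma + 2^-1 * sigma2 + phi2 * (sigma + 2 * eps))
            * m i * m j * m k
        /\
        Fa z * cartan Fbar i j k z =
          expR (2 * phia z)
          * (I * (1 + eps * sigma) + 2^-1 * sigma2 + phi2 * (sigma + 2 * eps))
          * m i * m j * m k,
      (* (ii), where the square root of eps / rho in mbar is real *)
      0 < eps * rho ->
        Ibar = ((eps * rho) `^ (3 / 2))
          * (I * (1 + eps * sigma) + 2^-1 * sigma2 + phi2 * (sigma + 2 * eps))
    & (* (iii) *)
      forall i j k : 'I_2,
        Fa z * cartan_up Fbar i j k z =
          eps * rho *
          (Fa z * cartan_up Fa i j k z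
           + (eps * I * sigma + 2^-1 * sigma2 + phi2 * (sigma + 2 * eps))
             * m' i * m j * m k
           - eps * phi2
             * (I * (1 + eps * sigma) + 2^-1 * sigma2
                + phi2 * (sigma + 2 * eps))
             * ell' i * m j * m k)].

Proof.
move=> Fa phia Fbar eps rho phi2 sigma sigma2 I Ibar m m' ell'.
case: F_finsler => [[_ Aopen _ _ Ascale] Fsm Fhom Fdet].
pose O := coord_dom A a.
have oO : open O by exact: Aopen.
have inA w : O w -> A (of_coords a w) by case.
have dil w t : O w -> of_coords a (dilate t w) = tscale t (of_coords a w).
  by move=> [wa _]; exact: of_coords_dilate.
have dilO w (t : R) : O w -> 0 < t -> O (dilate t w).
  move=> Ow t0; split; first by case: Ow.
  by rewrite dil//; apply: Ascale => //; exact: inA.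
have Fa_dil w (t : R) : O w -> 0 < t -> Fa (dilate t w) = t * Fa w.
  by move=> Ow t0; rewrite /Fa /coord_fun dil// Fhom ?expr1//; exact: inA.
have Fa_neq0 w : O w -> Fa w != 0 by move=> Ow; apply: F_neq0; exact: inA.
have phi0 : smooth0 O phia.
  split; first exact: phi_smooth.
  move=> w t Ow t0; rewrite /phia /coord_fun dil// phi_homogeneous ?mul1r//.
  exact: inA.
have Fa_det w : O w -> \det (g_mx Fa w) != 0 by exact: Fdet.
have Fa_sm : smooth_on O Fa by exact: Fsm.
have C i j k : Fa z * cartan Fa i j k z = I * m i * m j * m k.
  exact: (cartan_main_scalar oO dilO Fa_sm Fa_dil Fa_neq0 Fa_det).
have EE : expR (2 * phia z) = expR (phia z) * expR (phia z).
  by rewrite (expRM_natl 2) expr2.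
have Cbar i j k : Fa z * cartan Fbar i j k z = expR (2 * phia z)
    * (I * (1 + eps * sigma) + 2^-1 * sigma2 + phi2 * (sigma + 2 * eps))
    * m i * m j * m k.
  rewrite EE.
  exact: (cartan_conformal oO dilO Fa_sm Fa_dil Fa_neq0 Fa_det phi0).
split.
- move=> i j k; split; last exact: Cbar.
  (* The first form of (i) follows from the second by splitting I off I (1 + eps sigma) and reading
     I m_i m_j m_k as F C_ijk. *)
  apply: etrans (Cbar i j k) _.
  move: (C i j k); clear C Cbar EE; clearbody m I eps sigma sigma2 phi2.
  move: (Fa z * _) (expR _) (m i) (m j) (m k) => x e mi mj mk ->.
  by ring.
(* [rho] unfolds to the inverse of W. *)
- exact: (main_scalar_conformal oO dilO Fa_sm Fa_dil Fa_neq0 Fa_det phi0 z_dom).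
move=> i j k.
have Cup : Fa z * cartan_up Fa i j k z = I * m' i * m j * m k.
  exact: (cartan_up_m oO dilO Fa_sm Fa_dil Fa_neq0 Fa_det).
have Cbarup : Fa z * cartan_up Fbar i j k z = eps * rho
    * (I * (1 + eps * sigma) + 2^-1 * sigma2 + phi2 * (sigma + 2 * eps))
    * (m' i - eps * phi2 * ell' i) * m j * m k.
  apply: (cartan_up_conformal oO dilO Fa_sm Fa_dil Fa_neq0 Fa_det phi0 _ _ _ z_dom).
  exact: sigma_neq0.
apply: etrans Cbarup _; move: Cup; clear C Cbar EE.
clearbody m m' ell' I eps rho sigma sigma2 phi2.
move: (Fa z * _) (m j) (m k) (m' i) (ell' i) => x mj mk mi li ->.
by ring.
Qed.
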